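(* Let $n$ be a positive integer and let $d_1, \ldots, d_n$ be positive integers. Let $A_1, \ldots, A_n$ and $B_1, \ldots, B_n$ be positive semidefinite operators such that, for each $i \in \{1,\ldots,n\}$, $A_i$ and $B_i$ act on $\mathbb{C}^{d_i}$. Then $$\lambda\left( \bigotimes_{i=1}^n A_i + \bigotimes_{i=1}^n B_i \right) \preceq \bigotimes_{i=1}^n \lambda(A_i) + \bigotimes_{i=1}^n \lambda(B_i).$$
   Context: For a self-adjoint operator $X$ on a complex inner product space of finite dimension $d$, $\lambda_1(X) \geq \cdots \geq \lambda_d(X)$ denote its eigenvalues with multiplicity, and $\lambda(X) := (\lambda_i(X))_{i=1}^d \in \mathbb{R}^d$. For vectors $x, y \in \mathbb{R}^d$, $y \preceq x$ (''$x$ majorizes $y$'') means: for each $k \in \{1,\ldots,d-1\}$ the sum of the $k$ largest coordinates of $x$ is greater than or equal to the sum of the $k$ largest coordinates of $y$, and $\sum_{i=1}^d x_i = \sum_{i=1}^d y_i$. The tensor product of vectors $v^{(i)} \in \mathbb{R}^{d_i}$, $i = 1,\ldots,n$, is the vector in $\bigotimes_{i=1}^n \mathbb{R}^{d_i} \cong \mathbb{R}^{d_1\cdots d_n}$ whose coordinate indexed by $(x_1,\ldots,x_n) \in \prod_{i=1}^n \{1,\ldots,d_i\}$ is $\prod_{i=1}^n v^{(i)}_{x_i}$; the sum on the right-hand side is coordinatewise with respect to this indexing. *)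

(* Defs.v *)
From mathcomp Require Import all_boot all_order all_algebra.
From mathcomp Require Import reals.
From mathcomp Require Import complex.

Set Implicit Arguments.
Unset Strict Implicit.
Unset Printing Implicit Defensive.

Import Order.TTheory GRing.Theory Num.Theory.
Local Open Scope ring_scope.
Local Open Scope complex_scope.
Local Open Scope sesquilinear_scope.

Definition psdmx (R : realType) (d : nat) (A : 'M[R[i]]_d) : Prop :=
  A \is hermsymmx /\ forall v : 'cV[R[i]]_d, 0 <= (v ^t* *m A *m v) 0 0.

(* The complex roots of the characteristic polynomial, with multiplicity; they
   are real when A is Hermitian (see [char_poly_lambda]), so that taking real
   parts loses nothing in that case. *)
Definition eigenvals (R : realType) (d : nat) (A : 'M[R[i]]_d) : seq R :=
  sort >=%R
    [seq complex.Re z | z <- sval (closed_field_poly_normal (char_poly A))].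

Definition lambda (R : realType) (d : nat) (A : 'M[R[i]]_d) : 'rV[R]_d :=
  \row_(i < d) (eigenvals A)`_i.

Definition sum_largest (R : realType) (d : nat) (x : 'rV[R]_d) (k : nat) : R :=
  \sum_(z <- take k (sort >=%R [seq x 0 i | i <- enum 'I_d])) z.

(* x majorizes y *)
Definition majorized (R : realType) (d : nat) (y x : 'rV[R]_d) : Prop :=
  (forall k : nat, (1 <= k < d)%N -> sum_largest y k <= sum_largest x k) /\
  \sum_(i < d) x 0 i = \sum_(i < d) y 0 i.

(* Multi-indices (x_1, ..., x_n) with x_i in {0, ..., d_i - 1}. Coordinates of
   the n-fold tensor product are indexed by 'I_#|tindex d|, identified with
   tindex d by enum_val; #|tindex d| is the product of the d_i. *)
Definition tindex (n : nat) (d : 'I_n -> nat) : finType :=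
  {dffun forall i : 'I_n, 'I_(d i)}.

(* Matrix of the tensor product operator in the product basis. *)
Definition tensor_mx (R : realType) (n : nat) (d : 'I_n -> nat)
    (A : forall i : 'I_n, 'M[R[i]]_(d i)) : 'M[R[i]]_#|tindex d| :=
  \matrix_(a, b) \prod_(i < n)
    A i ((enum_val a : tindex d) i) ((enum_val b : tindex d) i).

Definition tensor_rv (R : realType) (n : nat) (d : 'I_n -> nat)
    (v : forall i : 'I_n, 'rV[R]_(d i)) : 'rV[R]_#|tindex d| :=
  \row_a \prod_(i < n) v i 0 ((enum_val a : tindex d) i).

Lemma card_tindex (n : nat) (d : 'I_n -> nat) :
  #|tindex d| = (\prod_(i < n) d i)%N.
Proof.
rewrite card_dep_ffun foldrE big_map -big_enum /=.
by apply: eq_bigr => i _; rewrite card_ord.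
Qed.

Lemma size_eigenvals (R : realType) (d : nat) (A : 'M[R[i]]_d) :
  size (eigenvals A) = d.
Proof.
rewrite size_sort size_map; case: closed_field_poly_normal => r /= Dr.
move: (size_char_poly A); rewrite {1}Dr (monicP (char_poly_monic A)) scale1r.
by rewrite size_prod_XsubC => -[].
Qed.

Lemma lambda_nonincreasing (R : realType) (d : nat) (A : 'M[R[i]]_d)
    (i j : 'I_d) : (i <= j)%N -> lambda A 0 j <= lambda A 0 i.
Proof.
move=> le_ij; rewrite !mxE.
have ge_total : total (>=%R : rel R) by move=> x y; exact: le_total.
have ge_trans : transitive (>=%R : rel R) by move=> y x z /[swap]; exact: le_trans.
have srt : sorted >=%R (eigenvals A) by exact: sort_sorted.
apply: (sorted_leq_nth ge_trans _ 0 srt) => //.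
- by move=> x; exact: lexx.
- by rewrite inE size_eigenvals.
- by rewrite inE size_eigenvals.
Qed.

Lemma char_poly_lambda (R : realType) (d : nat) (A : 'M[R[i]]_d) :
  A \is hermsymmx ->
  char_poly A = \prod_(i < d) ('X - ((lambda A 0 i)%:C)%:P).
Proof.
move=> hA; have := hermitian_spectral_diag_real hA.
have /orthomx_spectralP eA := hermitian_normalmx hA.
set D := spectral_diag A in eA *; move=> Dreal.
have cA : char_poly A = \prod_(i < d) ('X - (D 0 i)%:P).
  rewrite eA; set P := spectralmx A.
  have uP : P \in unitmx by exact: spectral_unit.
  have -> : char_poly (invmx P *m diag_mx D *m P) = char_poly (diag_mx D).
    rewrite /char_poly /char_poly_mx !map_mxM /= map_invmx.
    set Q := map_mx polyC P; set E := map_mx polyC _.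
    have uQ : Q \in unitmx by rewrite map_unitmx.
    have -> : 'X%:M - invmx Q *m E *m Q = invmx Q *m ('X%:M - E) *m Q.
      rewrite mulmxBr mulmxBl; congr (_ - _).
      by rewrite scalar_mxC -mulmxA mulVmx // mulmx1.
    by rewrite !det_mulmx mulrAC -det_mulmx mulVmx // det1 mul1r.
  rewrite char_poly_trig ?diag_mx_is_trig //.
  by apply: eq_bigr => i _; rewrite mxE eqxx mulr1n.
have cE : char_poly A = \prod_(z <- eigenvals A) ('X - (z%:C)%:P).
  rewrite /eigenvals; case: closed_field_poly_normal => r /=.
  rewrite (monicP (char_poly_monic A)) scale1r => Dr.
  rewrite (perm_big _ (permEl (perm_sort _ _))) big_map Dr /=.
  apply: eq_big_seq => z rz; congr ('X - _%:P).
  have : root (char_poly A) z by rewrite Dr root_prod_XsubC.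
  rewrite cA -(big_map (fun i => D 0 i) xpredT (fun z => 'X - z%:P)).
  rewrite root_prod_XsubC => /mapP[i _ ->].
  by rewrite RRe_real //; move/mxOverP: Dreal; apply.
rewrite cE (big_nth 0) size_eigenvals big_mkord.
by apply: eq_bigr => i _; rewrite mxE.
Qed.

(* Main.v *)
Require Import Defs.
From mathcomp Require Import all_boot all_order all_algebra.
From mathcomp Require Import reals.
From mathcomp Require Import complex.
From mathcomp Require Import perm ring.

Set Implicit Arguments.
Unset Strict Implicit.
Unset Printing Implicit Defensive.

Import Order.TTheory GRing.Theory Num.Theory.
Local Open Scope ring_scope.
Local Open Scope complex_scope.
Local Open Scope sesquilinear_scope.

(** Let [M^H] denote the conjugate transpose and [(x)] the tensor product.
    Write [A_i = X_i^H X_i] and [B_i = Y_i^H Y_i], and put [X = (x)X_i],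
    [Y = (x)Y_i].  The engine of the proof is the following swap.  Suppose that
    every [Y_i X_i^H] is Hermitian, so that [Y X^H] is Hermitian too.  Then for
    [R = X + iY] and [R' = X - iY] the cross terms of [R R^H] and [R' R'^H]
    cancel, and both are equal to [X X^H + Y Y^H], whereas [R^H R] and
    [R'^H R'] have average [X^H X + Y^H Y].  As [R^H R] and [R R^H] are
    unitarily similar, the sums of the largest eigenvalues of
    [X^H X + Y^H Y = (x)A_i + (x)B_i] are at most those of
    [X X^H + Y Y^H = (x)X_i X_i^H + (x)Y_i Y_i^H] (trace_sum_le_swap).  The
    factors [X_i X_i^H] and [Y_i Y_i^H] have the same spectra as [A_i] and
    [B_i], and the Hermitian condition can always be arranged by replacing
    [Y_i] with [W_i Y_i] for a unitary [W_i] taken from a polar decomposition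
    (polar_hermitian).  The condition is imposed factor by factor, so the swap
    stays inside the set of pairs of product operators.

    The swap also increases each [tr (A_i B_i)], strictly so unless [A_i] and
    [B_i] commute (trace_swap_eq_comm).  Fix the spectra, and consider the pairs
    of product operators for which the sum of the [k] largest eigenvalues of
    the sum is at least its initial value.  This set is compact, the swap maps
    it to itself, and therefore at a point that maximizes [sum_i tr (A_i B_i)]
    every [A_i] commutes with [B_i] (exists_commuting_compression).

    In the commuting case everything is diagonal in a product basis, and the
    eigenvalues of the sum are [prod_i a_i(s_i x_i) + prod_i b_i(t_i x_i)] for
    permutations [s_i], [t_i] of the index sets.  Majorization is tested by the
    sums of the positive parts of [_ - r]; these increase when [s_i] and [t_i]
    are replaced with the identity at one site after the other, because the
    lists [a_i] and [b_i] are sorted in the same order and are nonnegative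
    (total_excess_le_sorted).  Nonnegativity enters here, and in the
    factorizations [A_i = X_i^H X_i]. *)

(** * Adjoints, orthogonal rows and the polar decomposition *)

Section Adjoint.
Variable C : numClosedFieldType.

Lemma adjmxM m n p (A : 'M[C]_(m, n)) (B : 'M[C]_(n, p)) :
  (A *m B)^t* = B^t* *m A^t*.
Proof. by rewrite trmx_mul map_mxM. Qed.

Lemma adjmxD m n (A B : 'M[C]_(m, n)) : (A + B)^t* = A^t* + B^t*.
Proof. by rewrite linearD map_mxD. Qed.

Lemma adjmxB m n (A B : 'M[C]_(m, n)) : (A - B)^t* = A^t* - B^t*.
Proof. by rewrite linearB map_mxB. Qed.

Lemma adjmxZ m n c (A : 'M[C]_(m, n)) : (c *: A)^t* = (Num.conj c) *: A^t*.
Proof. by rewrite linearZ map_mxZ. Qed.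

Lemma adjmx_diag n (v : 'rV[C]_n) : (diag_mx v)^t* = diag_mx (map_mx Num.conj v).
Proof. by rewrite tr_diag_mx map_diag_mx. Qed.

Lemma hermsymP n (A : 'M[C]_n) : reflect (A^t* = A) (A \is hermsymmx).
Proof.
by apply: (iffP (is_hermitianmxP _ _ _)) => [|H]; rewrite expr0 scale1r.
Qed.

Lemma unitarymxVP n (U : 'M[C]_n) : U \is unitarymx -> U^t* *m U = 1%:M.
Proof. by rewrite -trmxC_unitary => /unitarymxP; rewrite trmxCK. Qed.

Lemma adj_gram_sqrt n (S D P : 'M[C]_n) :
  S \is hermsymmx -> S *m S = D -> (S *m P)^t* *m (S *m P) = P^t* *m D *m P.
Proof. by move=> /hermsymP hS <-; rewrite adjmxM hS !mulmxA. Qed.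

Lemma gram_sqrt n (S D P : 'M[C]_n) :
  S \is hermsymmx -> S *m S = D -> P \is unitarymx ->
  (S *m P) *m (S *m P)^t* = D.
Proof.
move=> /hermsymP hS <- Pu.
by rewrite adjmxM hS mulmxA -(mulmxA S) (unitarymxP Pu) mulmx1.
Qed.

Lemma adj_gram_unitary_sqrt n (W S D P : 'M[C]_n) :
  W \is unitarymx -> S \is hermsymmx -> S *m S = D ->
  (W *m (S *m P))^t* *m (W *m (S *m P)) = P^t* *m D *m P.
Proof.
move=> Wu hS SD; rewrite -(adj_gram_sqrt P hS SD) [in LHS]adjmxM mulmxA.
by rewrite -(mulmxA _ (W^t*)) unitarymxVP // mulmx1.
Qed.

Lemma gram_unitary_sqrt n (W S D P : 'M[C]_n) :
  S \is hermsymmx -> S *m S = D -> P \is unitarymx ->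
  (W *m (S *m P)) *m (W *m (S *m P))^t* = W *m D *m W^t*.
Proof.
by move=> hS SD Pu; rewrite -(gram_sqrt hS SD Pu) [in LHS]adjmxM !mulmxA.
Qed.

Lemma mxtrace_adjmx_ge0 m n (A : 'M[C]_(m, n)) : 0 <= \tr (A *m A^t*).
Proof.
apply: sumr_ge0 => i _; rewrite mxE; apply: sumr_ge0 => j _.
by rewrite !mxE mul_conjC_ge0.
Qed.

Lemma mxtrace_adjmx_eq0 m n (A : 'M[C]_(m, n)) : \tr (A *m A^t*) = 0 -> A = 0.
Proof.
move=> /eqP; rewrite /mxtrace psumr_eq0; last first.
  move=> i _; rewrite mxE; apply: sumr_ge0 => j _.
  by rewrite !mxE mul_conjC_ge0.
move=> /allP A0; apply/matrixP => i j; rewrite !mxE.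
have := A0 i (mem_index_enum i); rewrite mxE psumr_eq0; last first.
  by move=> l _; rewrite !mxE mul_conjC_ge0.
by move=> /allP/(_ j (mem_index_enum j)); rewrite !mxE mul_conjC_eq0 => /eqP.
Qed.

Lemma normalize_row n (u : 'rV[C]_n) : u != 0 ->
  exists c : C, (c *: u) *m (c *: u)^t* = 1%:M.
Proof.
move=> uN0; have uu : 0 < \tr (u *m u^t*).
  rewrite lt_neqAle mxtrace_adjmx_ge0 eq_sym andbT.
  by apply: contra uN0 => /eqP/mxtrace_adjmx_eq0 ->.
exists (sqrtC (\tr (u *m u^t*)))^-1.
rewrite adjmxZ geC0_conj ?invr_ge0 ?sqrtC_ge0 ?ltW //.
rewrite -scalemxAl -scalemxAr scalerA -invfM -expr2 sqrtCK.
rewrite trace_mx11 in uu *; rewrite [X in _ *: X]mx11_scalar scale_scalar_mx.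
by rewrite mulVf ?gt_eqF.
Qed.

(** A matrix whose rows are pairwise orthogonal is a real diagonal matrix times a
    unitary one.  Nonzero rows only need to be normalized.  A zero row is
    replaced by a unit vector orthogonal to all the rows, which lowers the
    number of zero rows, and its coefficient in the diagonal factor is set to
    zero afterwards. *)
Lemma orthogonal_rows_scaled n (T : 'M[C]_n) (v : 'rV[C]_n) :
  T *m T^t* = diag_mx v ->
  exists Q (w : 'rV[C]_n),
    [/\ Q \is unitarymx, map_mx Num.conj w = w & T = diag_mx w *m Q].
Proof.
have [k] := ubnP #|[set i | row i T == 0]|.
elim: k T v => // k IHk T v; rewrite ltnS => leTk TTv.
have [i /eqP Ti0|TN0] := pickP (fun i => row i T == 0).
  have [u uT uu] : exists2 u : 'rV[C]_n, u *m T^t* = 0 & u *m u^t* = 1%:M.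
    have [u uT uN0] : exists2 u : 'rV[C]_n, u *m T^t* = 0 & u != 0.
      have : kermx (T^t*) != 0.
        rewrite kermx_eq0 row_free_unit; apply/negP.
        rewrite map_unitmx unitmx_tr => /mulmxV TV.
        have : row i (T *m invmx T) = 0 by rewrite row_mul Ti0 mul0mx.
        rewrite TV => /rowP/(_ i); rewrite !mxE eqxx => /eqP.
        by rewrite oner_eq0.
      by move=> /rowV0Pn[u] /sub_kermxP uT uN0; exists u.
    have [c cu] := normalize_row uN0; exists (c *: u) => //.
    by rewrite -scalemxAl uT scaler0.
  have Tu : T *m u^t* = 0 by rewrite -[LHS]trmxCK adjmxM trmxCK uT trmx0 map_mx0.
  pose e : 'cV[C]_n := delta_mx i 0.
  pose T' := T + e *m u.
  have [] := IHk T' (v + delta_mx 0 i).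
  - apply: leq_trans leTk; apply: proper_card; apply/properP; split.
      apply/fintype.subsetP => j; rewrite !inE => /eqP T'j0; have [->|ji] := eqVneq j i.
        by rewrite Ti0.
      rewrite -T'j0 linearD /= row_mul; apply/eqP; rewrite -[LHS]addr0; congr (_ + _).
      rewrite -[row j e](_ : 0 = _) ?mul0mx //.
      by apply/rowP => l; rewrite !mxE (negPf ji).
    exists i; rewrite !inE ?Ti0 // linearD /= Ti0 add0r row_mul.
    rewrite -[row i e](_ : 1%:M = _) ?mul1mx; last first.
      by apply/matrixP => l l'; rewrite !mxE !ord1 !eqxx.
    by apply: contra_eq_neq uu => ->; rewrite mul0mx eq_sym oner_neq0.
  - rewrite /T' adjmxD mulmxDl !mulmxDr TTv adjmxM !mulmxA Tu mul0mx addr0.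
    rewrite -[e *m u *m T^t*]mulmxA uT mulmx0 add0r -[e *m u *m _]mulmxA uu mulmx1.
    rewrite linearD /=; congr (_ + _); apply/matrixP => a b.
    rewrite !mxE big_ord1 !mxE !eqxx !andbT andTb rmorph_nat -natrM mulnb.
    by case: eqVneq => [->|] /=; rewrite ?mul0rn // eq_sym; case: eqVneq.
  move=> Q [w [Qu wr T'E]].
  exists Q, (\row_j (w 0 j *+ (j != i))); split => //.
    by apply/rowP => j; rewrite !mxE rmorphMn -[in RHS]wr mxE.
  apply/matrixP => a b; have /matrixP/(_ a b) := T'E.
  rewrite !mul_diag_mx !mxE big_ord1 !mxE eqxx andbT.
  case: eqVneq => [-> _|_] /=; last by rewrite mul0r addr0.
  by have /rowP/(_ b) := Ti0; rewrite !mxE => ->; rewrite mul0r.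
have vE i : v 0 i = \tr (row i T *m (row i T)^t*).
  have /matrixP/(_ i i) := TTv; rewrite !mxE eqxx mulr1n => <-.
  rewrite trace_mx11 mxE; apply: eq_bigr => j _; by rewrite !mxE.
have v_gt0 i : 0 < v 0 i.
  rewrite vE lt_neqAle mxtrace_adjmx_ge0 eq_sym andbT.
  by apply/negP => /eqP/mxtrace_adjmx_eq0/eqP; rewrite TN0.
exists (diag_mx (\row_j (sqrtC (v 0 j))^-1) *m T), (\row_j sqrtC (v 0 j)).
have sr i : Num.conj (sqrtC (v 0 i)) = sqrtC (v 0 i).
  by rewrite geC0_conj ?sqrtC_ge0 ?ltW.
have sN0 i : sqrtC (v 0 i) != 0 by rewrite sqrtC_eq0 gt_eqF.
split.
- apply/unitarymxP; rewrite adjmxM adjmx_diag mulmxA -[X in X *m _]mulmxA TTv.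
  rewrite !mulmx_diag -diag_const_mx; congr diag_mx; apply/rowP => j.
  rewrite !mxE geC0_conj ?invr_ge0 ?sqrtC_ge0 ?ltW //.
  by rewrite -{2}[v 0 j]sqrtCK expr2 mulrA mulVf // mul1r mulfV.
- by apply/rowP => j; rewrite !mxE sr.
- rewrite mulmxA mulmx_diag -[LHS]mul1mx -diag_const_mx; congr (diag_mx _ *m _).
  by apply/rowP => j; rewrite !mxE mulfV.
Qed.

(** Polar decomposition, without the positivity of the Hermitian factor.  If [V]
    diagonalizes [T T^H] then the rows of [V T] are orthogonal, so that
    [V T = D Q] with [D] real diagonal and [Q] unitary, and [W = Q^H V] gives
    [W T = Q^H D Q]. *)
Lemma polar_hermitian n (T : 'M[C]_n) :
  exists2 W : 'M[C]_n, W \is unitarymx & W *m T \is hermsymmx.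
Proof.
pose S := T *m T^t*; have hS : S \is hermsymmx.
  by apply/hermsymP; rewrite /S adjmxM trmxCK.
have /orthomx_spectralP := hermitian_normalmx hS.
set V := spectralmx S; have Vu : V \is unitarymx by exact: spectral_unitarymx.
rewrite invmx_unitary //; move: (spectral_diag S) => D SE.
have [|Q [w [Qu wr VT]]] := @orthogonal_rows_scaled n (V *m T) D.
  rewrite adjmxM mulmxA -[V *m T *m _]mulmxA -/S SE !mulmxA.
  by rewrite (unitarymxP Vu) mul1mx -mulmxA (unitarymxP Vu) mulmx1.
exists (Q^t* *m V); first by rewrite mul_unitarymx ?trmxC_unitary.
apply/hermsymP; rewrite -mulmxA VT mulmxA !adjmxM trmxCK adjmx_diag wr.
by rewrite mulmxA.
Qed.

(** With [H = W R] Hermitian, [R^H R = H^2 = W (R R^H) W^H]: the compression of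
    [R^H R] to the span of the rows of [Q] is that of [R R^H] to the span of the
    rows of [Q W]. *)
Lemma mxtrace_unitary_conj k n (Q : 'M[C]_(k, n)) (W R : 'M[C]_n) :
  W \is unitarymx -> W *m R \is hermsymmx ->
  \tr (Q *m (R^t* *m R) *m Q^t*) =
  \tr ((Q *m W) *m (R *m R^t*) *m (Q *m W)^t*).
Proof.
move=> Wu /hermsymP hWR; congr (\tr _).
rewrite !adjmxM !mulmxA -[Q *m W *m R]mulmxA -hWR adjmxM mulmxA.
rewrite -[_ *m R^t* *m W^t*]mulmxA -adjmxM hWR.
rewrite !mulmxA; congr (_ *m _); rewrite -!mulmxA; congr (_ *m (_ *m _)).
by rewrite [RHS]mulmxA unitarymxVP // mul1mx.
Qed.

(** The Ky Fan sums of [X^H X + Y^H Y] are at most those of [X X^H + Y Y^H]: the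
    former operator is the average of [R^H R] over [R = X + iY] and [R = X - iY],
    and both of these satisfy [R R^H = X X^H + Y Y^H].  Hence one of the two
    does at least as well as the average on the given subspace. *)
Lemma trace_sum_le_swap k n (X Y : 'M[C]_n) (Q : 'M[C]_(k, n)) :
  Y *m X^t* \is hermsymmx -> Q \is unitarymx ->
  exists2 Q' : 'M[C]_(k, n), Q' \is unitarymx &
    \tr (Q *m (X^t* *m X + Y^t* *m Y) *m Q^t*) <=
    \tr (Q' *m (X *m X^t* + Y *m Y^t*) *m Q'^t*).
Proof.
move=> /hermsymP; rewrite adjmxM trmxCK => YX Qu.
pose N := X *m X^t* + Y *m Y^t*.
pose D := 'i *: (X^t* *m Y - Y^t* *m X).
(* The sign [s] selects [R = X + iY] or [R = X - iY]. *)
have half (s : C) : s * s = 1 -> Num.conj s = s ->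
    exists2 Q' : 'M[C]_(k, n), Q' \is unitarymx &
    \tr (Q *m (X^t* *m X + Y^t* *m Y + s *: D) *m Q^t*) = \tr (Q' *m N *m Q'^t*).
  move=> ss sr; pose R := X + (s * 'i) *: Y.
  have sNi : Num.conj (s * 'i) = - (s * 'i :> C) by rewrite rmorphM /= sr conjCi mulrN.
  have sii : (s * 'i) * - (s * 'i) = 1 :> C.
    by rewrite mulrN mulrACA ss mul1r -expr2 sqrCi opprK.
  have [W Wu hW] := polar_hermitian R.
  exists (Q *m W); first by rewrite mul_unitarymx.
  rewrite -[N](_ : R *m R^t* = _); last first.
    rewrite /R adjmxD adjmxZ sNi mulmxDl !mulmxDr -!scalemxAl -!scalemxAr.
    rewrite !scalerA sii scale1r YX scaleNr.
    by rewrite !addrA subrK.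
  rewrite -mxtrace_unitary_conj //; congr (\tr (_ *m _ *m _)).
  rewrite /R adjmxD adjmxZ sNi mulmxDl !mulmxDr -!scalemxAl -!scalemxAr.
  rewrite !scalerA [- _ * _]mulrC sii scale1r /D scalerBr scaleNr.
  by rewrite addrACA; congr (_ + _); rewrite addrC.
have [||Q1 Q1u E1] := half 1; rewrite ?mulr1 ?rmorph1 //.
have [||Q2 Q2u E2] := half (-1); rewrite ?mulrN1 ?opprK ?rmorphN ?rmorph1 //.
set t := \tr _.
have tt : t + t = \tr (Q1 *m N *m Q1^t*) + \tr (Q2 *m N *m Q2^t*).
  rewrite -E1 -E2 -[LHS]raddfD -[RHS]raddfD /=; congr (\tr _).
  rewrite -[LHS]mulmxDl -[RHS]mulmxDl; congr (_ *m _).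
  rewrite -[LHS]mulmxDr -[RHS]mulmxDr; congr (_ *m _).
  by rewrite scale1r scaleN1r [RHS]addrACA subrr addr0.
have ge0 (Z : 'M[C]_(k, n)) : 0 <= \tr (Z *m N *m Z^t*).
  rewrite /N mulmxDr mulmxDl raddfD /=; apply: addr_ge0; rewrite mulmxA -mulmxA -adjmxM;
  exact: mxtrace_adjmx_ge0.
have [le12|lt21] := real_leP (ger0_real (ge0 Q1)) (ger0_real (ge0 Q2)).
  exists Q2 => //; rewrite -(ler_pMn2r (ltn0Sn 1)) !mulr2n tt; exact: lerD.
exists Q1 => //; rewrite -(ler_pMn2r (ltn0Sn 1)) !mulr2n tt; exact: lerD (ltW lt21).
Qed.
End Adjoint.

(** * The effect of the swap on the trace of the product *)

Section Swap.
Variable C : numClosedFieldType.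

(** The increase of [tr (A B)] under the swap, for [A = X^2], [B = Y^H Y] and
    [B' = Y Y^H], is half the squared norm of [X Y - Y^H X].  The Hermitian
    condition [Y X = X Y^H] is what turns [tr (X Y X Y)] into [tr (A B)]. *)
Lemma trace_swap_defect n (X Y : 'M[C]_n) :
  X \is hermsymmx -> Y *m X \is hermsymmx ->
  \tr (X *m X *m (Y *m Y^t*)) + \tr (X *m X *m (Y *m Y^t*)) =
  \tr (X *m X *m (Y^t* *m Y)) + \tr (X *m X *m (Y^t* *m Y)) +
  \tr ((X *m Y - Y^t* *m X) *m (X *m Y - Y^t* *m X)^t*).
Proof.
move=> /hermsymP hX /hermsymP; rewrite adjmxM hX => hYX.
rewrite adjmxB !adjmxM trmxCK hX mulmxBl !mulmxBr !raddfB /=.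
have -> : \tr (X *m Y *m (Y^t* *m X)) = \tr (X *m X *m (Y *m Y^t*)).
  by rewrite mulmxA mxtrace_mulC !mulmxA.
have -> : \tr (Y^t* *m X *m (X *m Y)) = \tr (X *m X *m (Y *m Y^t*)).
  by rewrite -mulmxA mxtrace_mulC !mulmxA.
have -> : \tr (X *m Y *m (X *m Y)) = \tr (X *m X *m (Y^t* *m Y)).
  by rewrite -[X *m Y *m _]mulmxA [Y *m (X *m Y)]mulmxA -hYX !mulmxA.
have -> : \tr (Y^t* *m X *m (Y^t* *m X)) = \tr (X *m X *m (Y^t* *m Y)).
  rewrite -[Y^t* *m X *m _]mulmxA [X *m (Y^t* *m X)]mulmxA hYX.
  by rewrite -mulmxA mulmxA mxtrace_mulC.
set a := \tr _; set b := \tr _.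
by ring.
Qed.

Lemma trace_swap_le n (X Y : 'M[C]_n) :
  X \is hermsymmx -> Y *m X \is hermsymmx ->
  \tr (X *m X *m (Y^t* *m Y)) <= \tr (X *m X *m (Y *m Y^t*)).
Proof.
move=> hX hYX; rewrite -(ler_pMn2r (ltn0Sn 1)) !mulr2n trace_swap_defect //.
by rewrite lerDl mxtrace_adjmx_ge0.
Qed.

(** Equality forces [X Y = Y^H X]; with [Y X = X Y^H] this makes [Y], hence
    [Y^H Y], commute with [X^2]. *)
Lemma trace_swap_eq_comm n (X Y : 'M[C]_n) :
  X \is hermsymmx -> Y *m X \is hermsymmx ->
  \tr (X *m X *m (Y *m Y^t*)) = \tr (X *m X *m (Y^t* *m Y)) ->
  X *m X *m (Y^t* *m Y) = Y^t* *m Y *m (X *m X).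
Proof.
move=> hX hYX E; have := trace_swap_defect hX hYX; rewrite E.
rewrite -[LHS]addr0 => /addrI/esym/mxtrace_adjmx_eq0/subr0_eq XY.
move/hermsymP: hX => hX; move/hermsymP: hYX; rewrite adjmxM hX => hYX.
have AY : X *m X *m Y = Y *m (X *m X).
  by rewrite -mulmxA XY mulmxA hYX mulmxA.
have YA : X *m X *m Y^t* = Y^t* *m (X *m X).
  by have := congr1 (fun M : 'M[C]_n => M^t*) AY; rewrite /= !adjmxM hX.
by rewrite mulmxA YA -mulmxA AY mulmxA.
Qed.
End Swap.

(** * Tensor products *)

(** Distributivity for dependent families, where the index set of the sum varies
    with the factor. *)
Lemma prodr_sum_dffun (R : comPzSemiRingType) (n : nat) (d : 'I_n -> nat)
    (F : forall i : 'I_n, 'I_(d i) -> R) :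
  \prod_i \sum_j F i j = \sum_(x : tindex d) \prod_i F i (x i).
Proof.
pose G i := [ffun j => F i j].
transitivity (\prod_i \sum_j G i j).
  by apply: eq_bigr => i _; apply: eq_bigr => j _; rewrite ffunE.
under eq_bigr do rewrite (big_tag (fun i j => G i j)).
rewrite bigA_distr_big_dep -(big_fprod _ _ G) (reindex (@dffun_of_fprod _ _)) /=.
  by apply: eq_bigr => t _; apply: eq_bigr => i _; rewrite !ffunE.
by apply: onW_bij; exact: dffun_of_fprod_bij.
Qed.

Lemma sum_enum_tindex (R : nmodType) (n : nat) (d : 'I_n -> nat) (F : tindex d -> R) :
  \sum_x F x = \sum_(a < #|tindex d|) F (enum_val a).
Proof. by rewrite (reindex (@enum_val (tindex d) (tindex d))) //; exact/onW_bij/enum_val_bij. Qed.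

Section Tensor.
Variables (R : realType) (n : nat) (d : 'I_n -> nat).
Implicit Types A B : forall i : 'I_n, 'M[R[i]]_(d i).

Lemma eq_tensor_mx A B : (forall i, A i = B i) -> tensor_mx A = tensor_mx B.
Proof.
by move=> eqAB; apply/matrixP => a b; rewrite !mxE; apply: eq_bigr => i _; rewrite eqAB.
Qed.

Lemma tensor_mxM A B :
  tensor_mx A *m tensor_mx B = tensor_mx (fun i => A i *m B i).
Proof.
apply/matrixP => a b; rewrite !mxE; under [RHS]eq_bigr do rewrite mxE.
rewrite prodr_sum_dffun sum_enum_tindex.
by apply: eq_bigr => x _; rewrite !mxE -big_split.
Qed.

Lemma tensor_mx_adj A : (tensor_mx A)^t* = tensor_mx (fun i => (A i)^t*).
Proof.
apply/matrixP => a b; rewrite !mxE rmorph_prod.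
by apply: eq_bigr => i _; rewrite !mxE.
Qed.

Lemma tensor_mx_diag (v : forall i : 'I_n, 'rV[R[i]]_(d i)) :
  tensor_mx (fun i => diag_mx (v i)) =
  diag_mx (\row_a \prod_i v i 0 ((enum_val a : tindex d) i)).
Proof.
apply/matrixP => a b; rewrite !mxE; have [<-|ab] := eqVneq a b.
  by rewrite mulr1n; apply: eq_bigr => i _; rewrite mxE eqxx.
rewrite mulr0n; apply/eqP; rewrite prodf_seq_eq0; apply/hasP.
have [i xi] : exists i, (enum_val a : tindex d) i != (enum_val b : tindex d) i.
  apply/existsP; rewrite -negb_forall; apply: contra ab => /forallP eqab.
  by apply/eqP/enum_val_inj/ffunP => i; apply/eqP.
by exists i; rewrite ?mem_index_enum //= mxE (negPf xi).
Qed.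

Lemma tensor_mx1 : tensor_mx (fun i => 1%:M : 'M[R[i]]_(d i)) = 1%:M.
Proof.
rewrite -(eq_tensor_mx (fun i => diag_const_mx _ 1)) tensor_mx_diag -diag_const_mx.
by congr diag_mx; apply/rowP => a; rewrite !mxE big1 // => i _; rewrite mxE.
Qed.

Lemma tensor_mx_unitary A :
  (forall i, A i \is unitarymx) -> tensor_mx A \is unitarymx.
Proof.
move=> Au; apply/unitarymxP; rewrite tensor_mx_adj tensor_mxM -tensor_mx1.
by apply: eq_tensor_mx => i; apply/unitarymxP.
Qed.

Lemma tensor_mx_herm A :
  (forall i, A i \is hermsymmx) -> tensor_mx A \is hermsymmx.
Proof.
move=> Ah; apply/hermsymP; rewrite tensor_mx_adj.
by apply: eq_tensor_mx => i; apply/hermsymP.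
Qed.

Lemma mxtrace_tensor A : \tr (tensor_mx A) = \prod_i \tr (A i).
Proof.
rewrite /mxtrace prodr_sum_dffun sum_enum_tindex.
by apply: eq_bigr => x _; rewrite mxE.
Qed.
End Tensor.

(** * Rearrangement of positive parts *)

Section Rearrangement.
Variable R : realFieldType.

Definition pos_part (x : R) := Num.max x 0.

Lemma pos_part_ge x : x <= pos_part x. Proof. by rewrite le_max lexx. Qed.
Lemma pos_part_ge0 x : 0 <= pos_part x. Proof. by rewrite le_max lexx orbT. Qed.

Lemma card_initial m k : (k <= m)%N -> #|[pred l : 'I_m | (l < k)%N]| = k.
Proof. by move=> km; rewrite -sum1_card -(big_ord_widen m (fun=> 1%N) km) sum1_card card_ord. Qed.

Lemma sum_le_sum_initial m (al : 'I_m -> R) (S : {set 'I_m}) :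
  (forall i j : 'I_m, (i <= j)%N -> al j <= al i) ->
  \sum_(l in S) al l <= \sum_(l < m | (l < #|S|)%N) al l.
Proof.
move=> al_mono; have leSm : (#|S| <= m)%N by rewrite -[m in (_ <= m)%N]card_ord max_card.
have [Sm|mS] := ltnP #|S| m; last first.
  have -> : S = [set: 'I_m] by apply/eqP; rewrite eqEcard finset.subsetT cardsT card_ord.
  rewrite cardsT card_ord le_eqVlt; apply/orP; left; apply/eqP.
  by apply: eq_bigl => l; rewrite inE ltn_ord.
(* Shifting by the first value left out makes the positive terms those
   of the initial segment, up to zeros. *)
pose t := al (Ordinal Sm).
apply: (@le_trans _ _ (\sum_(l in S) t + \sum_l pos_part (al l - t))).
  rewrite -lerBlDl -sumrB [leRHS](bigID (mem S)) /= -[leLHS]addr0.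
  by rewrite lerD ?ler_sum ?sumr_ge0 // => l _; rewrite ?pos_part_ge ?pos_part_ge0.
rewrite [X in _ + X](bigID (fun l : 'I_m => (l < #|S|)%N)) /= addrA [X in _ + X]big1 => [|l].
  rewrite addr0 sumr_const -[X in _ *+ X](card_initial leSm) -sumr_const -big_split /=.
  apply: ler_sum => l lS; rewrite /pos_part max_l.
    by rewrite addrC subrK.
  by rewrite subr_ge0 al_mono // ltnW.
by rewrite -leqNgt => Sl; rewrite /pos_part max_r // subr_le0 al_mono.
Qed.

(** Both sides are governed by their positive terms.  If [S] is the set of the
    positive terms on the left, the sum over [S] is at most the sum of the first
    [#|S|] terms on the right, since this holds separately for the two
    nonincreasing sequences. *)
Lemma sum_pos_part_rearrange m (al be : 'I_m -> R) (s t : 'S_m) (c e r : R) :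
  0 <= c -> 0 <= e ->
  (forall i j : 'I_m, (i <= j)%N -> al j <= al i) ->
  (forall i j : 'I_m, (i <= j)%N -> be j <= be i) ->
  \sum_l pos_part (al (s l) * c + be (t l) * e - r) <=
  \sum_l pos_part (al l * c + be l * e - r).
Proof.
move=> c0 e0 al_mono be_mono.
pose S := [set l | 0 < al (s l) * c + be (t l) * e - r].
have -> : \sum_l pos_part (al (s l) * c + be (t l) * e - r) =
          \sum_(l in S) (al (s l) * c + be (t l) * e - r).
  rewrite [RHS]big_mkcond; apply: eq_bigr => l _; rewrite inE /pos_part.
  by case: ltP.
apply: (@le_trans _ _ (\sum_(l < m | (l < #|S|)%N) (al l * c + be l * e - r))).
  have leSm : (#|S| <= m)%N by rewrite -[m in (_ <= m)%N]card_ord max_card.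
  rewrite !sumrB lerB //; last first.
    by rewrite !sumr_const (card_initial leSm).
  rewrite !big_split -!mulr_suml /=.
  have H (u : 'S_m) (ga : 'I_m -> R) :
      (forall i j : 'I_m, (i <= j)%N -> ga j <= ga i) ->
      \sum_(l in S) ga (u l) <= \sum_(l < m | (l < #|S|)%N) ga l.
    move=> ga_mono; rewrite -(card_imset _ (@perm_inj _ u)).
    rewrite -(big_imset _ (in2W (@perm_inj _ u))) /=; exact: sum_le_sum_initial.
  by rewrite lerD ?ler_wpM2r ?H.
rewrite [leRHS](bigID (fun l : 'I_m => (l < #|S|)%N)) /= -[leLHS]addr0.
by rewrite lerD ?ler_sum ?sumr_ge0 // => l _; rewrite ?pos_part_ge ?pos_part_ge0.
Qed.
End Rearrangement.

Section TensorRearrangement.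
Variables (R : realFieldType) (n : nat) (d : 'I_n -> nat).

Definition update_site (y : tindex d) i (l : 'I_(d i)) : tindex d :=
  finfun (dfwith (fun j => y j) l).

Lemma update_site_in (y : tindex d) i (l : 'I_(d i)) : update_site y l i = l.
Proof. by rewrite ffunE dfwith_in. Qed.

Lemma update_site_out (y : tindex d) i (l : 'I_(d i)) j : j != i -> update_site y l j = y j.
Proof. by rewrite eq_sym => ij; rewrite ffunE dfwith_out. Qed.

Lemma update_site_id (y : tindex d) i (l m : 'I_(d i)) : y i = m ->
  update_site (update_site y l) m = y.
Proof.
move=> yi; apply/ffunP => j; have [->|ji] := eqVneq j i.
  by rewrite update_site_in.
by rewrite !update_site_out.
Qed.

(** Summing first over one coordinate: each fibre is indexed by its member whose
    [i]-th coordinate is the base point [l0]. *)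
Lemma sum_tindex_site i (l0 : 'I_(d i)) (G : tindex d -> R) :
  \sum_x G x = \sum_(y : tindex d | y i == l0) \sum_(l < d i) G (update_site y l).
Proof.
rewrite pair_big_dep /=.
rewrite (reindex_onto (fun x => (update_site x l0, x i))
  (fun p => update_site p.1 p.2)) /=; last first.
  move=> [y l] /= /andP[/eqP yi _].
  by rewrite update_site_in update_site_id.
apply: eq_big => [x|x _]; first by rewrite update_site_in eqxx update_site_id // eqxx.
by rewrite update_site_id.
Qed.

Lemma prod_update_site (F : forall i : 'I_n, 'I_(d i) -> R) (y : tindex d) i (l : 'I_(d i)) :
  \prod_j F j (update_site y l j) = F i l * \prod_(j | j != i) F j (y j).
Proof.
rewrite (bigD1 i) //= update_site_in; congr (_ * _).
by apply: eq_bigr => j ji; rewrite update_site_out.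
Qed.

(** Majorization by a vector is equivalent, for vectors of equal sums, to the
    comparison of these sums for all thresholds [r]. *)
Definition total_excess (a b : forall i : 'I_n, 'I_(d i) -> R) (r : R)
    (s t : forall i : 'I_n, 'S_(d i)) :=
  \sum_(x : tindex d)
    pos_part (\prod_i a i (s i (x i)) + \prod_i b i (t i (x i)) - r).

(** With the other coordinates fixed, the two products are nonnegative multiples
    of [a i] and [b i], and the one-site rearrangement applies. *)
Lemma total_excess_site (a b : forall i : 'I_n, 'I_(d i) -> R) i (l0 : 'I_(d i))
    r (s t s' t' : forall i : 'I_n, 'S_(d i)) :
  (forall i l, 0 <= a i l) -> (forall i l, 0 <= b i l) ->
  (forall l m : 'I_(d i), (l <= m)%N -> a i m <= a i l) ->
  (forall l m : 'I_(d i), (l <= m)%N -> b i m <= b i l) ->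
  s' i = 1%g -> t' i = 1%g ->
  (forall j, j != i -> s' j = s j) -> (forall j, j != i -> t' j = t j) ->
  total_excess a b r s t <= total_excess a b r s' t'.
Proof.
move=> a_ge0 b_ge0 a_mono b_mono s'i t'i s's t't.
rewrite /total_excess !(sum_tindex_site l0); apply: ler_sum => y _.
pose c := \prod_(j | j != i) a j (s j (y j)).
pose e := \prod_(j | j != i) b j (t j (y j)).
rewrite (eq_bigr (fun l => pos_part (a i (s i l) * c + b i (t i l) * e - r))); last first.
  move=> l _; rewrite (prod_update_site (fun j m => a j (s j m))).
  by rewrite (prod_update_site (fun j m => b j (t j m))).
rewrite [leRHS](eq_bigr (fun l => pos_part (a i l * c + b i l * e - r))); last first.
  move=> l _; rewrite (prod_update_site (fun j m => a j (s' j m))).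
  rewrite (prod_update_site (fun j m => b j (t' j m))) s'i t'i !perm1.
  congr (pos_part (_ * _ + _ * _ - _)); apply: eq_bigr => j ji.
    by rewrite s's.
  by rewrite t't.
by apply: sum_pos_part_rearrange; rewrite ?prodr_ge0.
Qed.

Lemma total_excess_le_sorted (a b : forall i : 'I_n, 'I_(d i) -> R) r
    (s t : forall i : 'I_n, 'S_(d i)) :
  (forall i l, 0 <= a i l) -> (forall i l, 0 <= b i l) ->
  (forall i (l m : 'I_(d i)), (l <= m)%N -> a i m <= a i l) ->
  (forall i (l m : 'I_(d i)), (l <= m)%N -> b i m <= b i l) ->
  total_excess a b r s t <= total_excess a b r (fun=> 1%g) (fun=> 1%g).
Proof.
move=> a_ge0 b_ge0 a_mono b_mono.
have [x0 _|no_x] := pickP (xpredT : pred (tindex d)); last first.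
  by rewrite /total_excess !big_pred0.
pose on (e : seq 'I_n) (u : forall i : 'I_n, 'S_(d i)) i : 'S_(d i) :=
  if i \in e then 1%g else u i.
have le_on e : total_excess a b r s t <= total_excess a b r (on e s) (on e t).
  elim: e => [|i e IHe]; first by rewrite lexx.
  apply: le_trans IHe _; apply: (@total_excess_site _ _ i (x0 i)) => //.
  - exact: a_mono.
  - exact: b_mono.
  - by rewrite /on in_cons eqxx.
  - by rewrite /on in_cons eqxx.
  - by move=> j ji; rewrite /on in_cons (negPf ji).
  - by move=> j ji; rewrite /on in_cons (negPf ji).
apply: le_trans (le_on (enum 'I_n)) _; rewrite /total_excess le_eqVlt; apply/orP; left.
apply/eqP; apply: eq_bigr => x _; congr (pos_part (_ + _ - _));
by apply: eq_bigr => i _; rewrite /on mem_enum.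
Qed.
End TensorRearrangement.

(** * Spectra of Hermitian matrices and Ky Fan sums *)

Section UnitaryDiagonalization.
Variable C : numClosedFieldType.

Lemma char_poly_unitary_conj d (P : 'M[C]_d) (v : 'rV[C]_d) : P \is unitarymx ->
  char_poly (P^t* *m diag_mx v *m P) = \prod_j ('X - (v 0 j)%:P).
Proof.
move=> Pu; have uP := unitarymx_unit Pu.
transitivity (char_poly (diag_mx v)); last first.
  rewrite char_poly_trig ?diag_mx_is_trig //.
  by apply: eq_bigr => j _; rewrite mxE eqxx mulr1n.
rewrite -invmx_unitary // /char_poly /char_poly_mx !map_mxM /= map_invmx.
set Q := map_mx polyC P; set E := map_mx polyC _.
have uQ : Q \in unitmx by rewrite map_unitmx.
have -> : 'X%:M - invmx Q *m E *m Q = invmx Q *m ('X%:M - E) *m Q.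
  rewrite mulmxBr mulmxBl; congr (_ - _).
  by rewrite scalar_mxC -mulmxA mulVmx // mulmx1.
by rewrite !det_mulmx mulrAC -det_mulmx mulVmx // det1 mul1r.
Qed.

Lemma eq_prod_XsubC_perm d (v w : 'rV[C]_d) :
  \prod_j ('X - (v 0 j)%:P) = \prod_j ('X - (w 0 j)%:P) ->
  exists s : 'S_d, forall j, w 0 j = v 0 (s j).
Proof.
move=> E; have : perm_eq [tuple w 0 j | j < d] [tuple v 0 j | j < d].
  apply: prod_XsubC_eq; rewrite !big_map.
  by rewrite -!enumT !big_enum.
case/tuple_permP => s /val_inj Es; exists s => j.
by have := congr1 (fun t => tnth t j) Es; rewrite /= !tnth_mktuple.
Qed.

(** Commuting matrices are triangular in a common orthonormal basis, and a
    Hermitian triangular matrix is diagonal; the diagonal entries are the given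
    eigenvalues in some order, as the characteristic polynomial shows. *)
Lemma comm_diag_unitary_conj d (a b : 'rV[C]_d) (U V : 'M[C]_d) :
  map_mx Num.conj a = a -> map_mx Num.conj b = b ->
  U \is unitarymx -> V \is unitarymx ->
  let A := U^t* *m diag_mx a *m U in let B := V^t* *m diag_mx b *m V in
  A *m B = B *m A ->
  exists P (s t : 'S_d), [/\ P \is unitarymx,
    A = P^t* *m diag_mx (\row_j a 0 (s j)) *m P &
    B = P^t* *m diag_mx (\row_j b 0 (t j)) *m P].
Proof.
move=> ar br Uu Vu A B /cotrigonalization2[P Pu /andP[tA tB]].
have diag (c : 'rV[C]_d) (W : 'M[C]_d) : map_mx Num.conj c = c -> W \is unitarymx ->
    similar_trig P (W^t* *m diag_mx c *m W) ->
    exists s : 'S_d, W^t* *m diag_mx c *m W = P^t* *m diag_mx (\row_j c 0 (s j)) *m P.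
  move=> cr Wu; set M := _ *m W => tM.
  have hM : M^t* = M by rewrite !adjmxM trmxCK adjmx_diag cr mulmxA.
  have [D MD] : exists D : 'rV[C]_d, M = P^t* *m diag_mx D *m P.
    have Punit := unitarymx_unit Pu.
    have : similar_diag P M.
      apply/similar_diagPp => // i j; case: ltngtP => // [lt_ij|lt_ji] _.
        by have /is_trig_mxP-> := tM.
      have /is_trig_mxP -/(_ j i lt_ji)/eqP := tM.
      rewrite -{1}hM !conjumx// invmx_unitary // -[P as X in X *m _]trmxCK.
      by rewrite -!adjmxM mulmxA 2!mxE conjC_eq0 => /eqP.
    move=> /similar_diagPex[D] PMD; exists D.
    by rewrite -invmx_unitary // -conjVmx//; exact/similarLR.
  have := congr1 char_poly MD.
  rewrite (char_poly_unitary_conj _ Wu) (char_poly_unitary_conj _ Pu).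
  move=> /eq_prod_XsubC_perm[s Ds]; exists s; rewrite MD; congr (_ *m diag_mx _ *m _).
  by apply/rowP => j; rewrite Ds mxE.
have [s As] := diag a U ar Uu tA; have [t Bt] := diag b V br Vu tB.
by exists P, s, t.
Qed.

End UnitaryDiagonalization.

Section Spectral.
Variable R : realType.
Local Notation C := R[i].

Definition cdiag d (v : 'rV[R]_d) : 'M[C]_d := diag_mx (map_mx (real_complex R) v).

Lemma conj_real_row d (v : 'rV[R]_d) :
  map_mx Num.conj (map_mx (real_complex R) v) = map_mx (real_complex R) v.
Proof. by apply/rowP => j; rewrite !mxE; exact: conjc_real. Qed.

Lemma cdiag_herm d (v : 'rV[R]_d) : cdiag v \is hermsymmx.
Proof.
by apply/hermsymP; rewrite adjmx_diag conj_real_row.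
Qed.

Lemma hermitian_diag_lambda d (A : 'M[C]_d) : A \is hermsymmx ->
  exists2 P : 'M[C]_d, P \is unitarymx & A = P^t* *m cdiag (lambda A) *m P.
Proof.
move=> hA; have /orthomx_spectralP eA := hermitian_normalmx hA.
have Vu := spectral_unitarymx A; rewrite invmx_unitary // in eA.
move: (spectralmx A) (spectral_diag A) Vu eA => V D Vu eA.
have [|s Ds] := @eq_prod_XsubC_perm _ d D (map_mx (real_complex R) (lambda A)).
  rewrite -(char_poly_unitary_conj _ Vu) -eA char_poly_lambda //.
  by apply: eq_bigr => j _; rewrite [map_mx _ _ 0 j]mxE.
exists (row_perm s V).
  apply/unitarymxP; rewrite row_permE adjmxM -mulmxA [V *m _]mulmxA.
  by rewrite (unitarymxP Vu) mul1mx tr_perm_mx map_perm_mx -perm_mxM mulgV perm_mx1.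
rewrite {1}eA; apply/matrixP => a b; rewrite !mxE (reindex_perm s).
apply: eq_bigr => j _; rewrite !mul_mx_diag !mxE.
by rewrite -Ds !mxE.
Qed.

Lemma comm_hermitian_diag d (a b : 'rV[R]_d) (U V : 'M[C]_d) :
  U \is unitarymx -> V \is unitarymx ->
  let A := U^t* *m cdiag a *m U in let B := V^t* *m cdiag b *m V in
  A *m B = B *m A ->
  exists P (s t : 'S_d), [/\ P \is unitarymx,
    A = P^t* *m cdiag (\row_j a 0 (s j)) *m P &
    B = P^t* *m cdiag (\row_j b 0 (t j)) *m P].
Proof.
move=> Uu Vu A B comm.
have [P [s [t [Pu As Bt]]]] :=
  comm_diag_unitary_conj (conj_real_row a) (conj_real_row b) Uu Vu comm.
have cdiagE (v : 'rV[R]_d) (u : 'S_d) :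
    cdiag (\row_j v 0 (u j)) = diag_mx (\row_j map_mx (real_complex R) v 0 (u j)).
  by congr diag_mx; apply/rowP => j; rewrite !mxE.
exists P, s, t; split; [exact: Pu|rewrite cdiagE; exact: As|rewrite cdiagE; exact: Bt].
Qed.

Lemma psdmx_lambda_ge0 d (A : 'M[C]_d) i : psdmx A -> 0 <= lambda A 0 i.
Proof.
move=> [hA posA]; have [P Pu AP] := hermitian_diag_lambda hA.
have := posA (P^t* *m delta_mx i 0).
have -> : (P^t* *m delta_mx i 0)^t* *m A *m (P^t* *m delta_mx i 0) =
          row i (col i (cdiag (lambda A))).
  rewrite [X in _ *m X *m _]AP adjmxM trmxCK !mulmxA.
  rewrite -[_ *m P *m P^t*]mulmxA (unitarymxP Pu) mulmx1.
  rewrite -[_ *m P *m P^t*]mulmxA (unitarymxP Pu) mulmx1.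
  by rewrite trmx_delta map_delta_mx -rowE -colE; apply/matrixP => p q; rewrite !mxE.
by rewrite !mxE eqxx mulr1n ler0c.
Qed.
End Spectral.

Section Largest.
Variable R : realType.
Local Notation C := R[i].

Lemma ge_trans_real : transitive (>=%R : rel R).
Proof. by move=> y x z /[swap]; exact: le_trans. Qed.

(** The [k]-th largest entry serves as the threshold. *)
Lemma sum_largest_threshold d (h : 'rV[R]_d) k : (0 < k <= d)%N ->
  exists r, sum_largest h k = r *+ k + \sum_x pos_part (h 0 x - r).
Proof.
move=> /andP[k_gt0 kd]; rewrite /sum_largest.
set s := sort _ _; have sz : size s = d by rewrite size_sort size_map size_enum_ord.
have srt : sorted >=%R s by apply: sort_sorted => x y; exact: le_total.
have nth_mono i j : (i <= j < d)%N -> s`_j <= s`_i.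
  move=> /andP[ij jd]; apply: (sorted_leq_nth ge_trans_real _ 0 srt) => //;
  rewrite ?inE ?sz ?(leq_ltn_trans ij) //; exact: lexx.
pose r := s`_k.-1; exists r.
have -> : \sum_x pos_part (h 0 x - r) = \sum_(0 <= i < d) pos_part (s`_i - r).
  rewrite -[in RHS]sz -(big_nth 0 xpredT (fun z => pos_part (z - r))).
  by rewrite (perm_big _ (permEl (perm_sort _ _))) big_map big_enum.
rewrite (big_nth 0) size_take sz -/(minn k d) (minn_idPl kd).
rewrite [X in _ + X](big_cat_nat (leq0n k) kd) /= [X in _ + (_ + X)]big_nat_cond.
rewrite [X in _ + (_ + X)]big1 => [|i /andP[/andP[ki id] _]].
  rewrite addr0 -[r *+ k](_ : \sum_(0 <= i < k) r = _) -?big_split /=; last first.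
    by rewrite big_mkord sumr_const card_ord.
  rewrite big_nat [RHS]big_nat; apply: eq_bigr => i /andP[_ ik].
  have rsi : 0 <= s`_i - r.
    by rewrite subr_ge0 nth_mono // -ltnS prednK // ik.
  by rewrite nth_take // /pos_part max_l // addrC subrK.
rewrite /pos_part max_r // subr_le0 nth_mono // id andbT.
by rewrite (leq_trans _ ki) // leq_pred.
Qed.

Lemma sum_largest_lambda d (A : 'M[C]_d) k (kd : (k <= d)%N) :
  sum_largest (lambda A) k = \sum_(i < k) lambda A 0 (widen_ord kd i).
Proof.
rewrite /sum_largest [map _ _](_ : _ = eigenvals A); last first.
  apply: (@eq_from_nth _ 0); first by rewrite size_map size_enum_ord size_eigenvals.
  move=> i; rewrite size_map size_enum_ord => id.
  by rewrite (nth_map (Ordinal id)) ?size_enum_ord // mxE nth_enum_ord.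
rewrite sorted_sort; [|exact: ge_trans_real|]; last first.
  by apply: sort_sorted => x y; exact: le_total.
rewrite (big_nth 0) size_take size_eigenvals -/(minn k d) (minn_idPl kd) big_mkord.
by apply: eq_bigr => i _; rewrite nth_take // mxE.
Qed.

(** The first [k] vectors of an orthonormal eigenbasis sorted by decreasing
    eigenvalue attain the Ky Fan sum. *)
Lemma sum_largest_attained d (A : 'M[C]_d) k : A \is hermsymmx -> (k <= d)%N ->
  exists2 Q : 'M[C]_(k, d), Q \is unitarymx &
    \tr (Q *m A *m Q^t*) = (sum_largest (lambda A) k)%:C.
Proof.
move=> hA kd; have [P Pu AP] := hermitian_diag_lambda hA.
pose f := widen_ord kd; exists (rowsub f P).
  apply/unitarymxP/matrixP => i j; have /unitarymxP/matrixP/(_ (f i) (f j)) := Pu.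
  rewrite !mxE => PP; rewrite -[RHS]/((i == j :> nat)%:R : C).
  by rewrite -[RHS]PP; apply: eq_bigr => l _; rewrite !mxE.
have PA : P *m A *m P^t* = cdiag (lambda A).
  rewrite [in LHS]AP !mulmxA (unitarymxP Pu) mul1mx -mulmxA.
  by rewrite (unitarymxP Pu) mulmx1.
rewrite (sum_largest_lambda A kd) rmorph_sum /=; apply: eq_bigr => i _.
have /matrixP/(_ (f i) (f i)) := PA; rewrite [RHS]mxE eqxx mulr1n [RHS]mxE => <-.
rewrite !mxE; apply: eq_bigr => j _; rewrite !mxE; congr (_ * _).
by apply: eq_bigr => l _; rewrite !mxE.
Qed.

(** In the eigenbasis the trace of the compression is a combination of the
    eigenvalues with weights in [0, 1] that add up to [k]. *)
Lemma trace_compression_le k d (Q : 'M[C]_(k, d)) (P : 'M[C]_d) (v : 'rV[R]_d) r :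
  Q \is unitarymx -> P \is unitarymx ->
  \tr (Q *m (P^t* *m cdiag v *m P) *m Q^t*) <=
  (r *+ k + \sum_x pos_part (v 0 x - r))%:C.
Proof.
move=> Qu Pu; have [Z ZE Zu] : exists2 Z, Z = Q *m P^t* & Z *m Z^t* = 1%:M.
  by exists (Q *m P^t*) => //; apply/unitarymxP; rewrite mul_unitarymx ?trmxC_unitary.
pose w x := (Z^t* *m Z) x x.
have -> : \tr (Q *m (P^t* *m cdiag v *m P) *m Q^t*) = \sum_x (v 0 x)%:C * w x.
  transitivity (\tr (cdiag v *m (Z^t* *m Z))).
    by rewrite [in RHS]mulmxA [RHS]mxtrace_mulC ZE adjmxM trmxCK !mulmxA.
  by apply: eq_bigr => x _; rewrite mul_diag_mx mxE [X in X * _]mxE.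
have w_ge0 x : 0 <= w x.
  rewrite /w mxE; apply: sumr_ge0 => j _.
  by rewrite !mxE mulrC mul_conjC_ge0.
have w_le1 x : w x <= 1.
  pose G := 1%:M - Z^t* *m Z.
  have proj : Z^t* *m Z *m (Z^t* *m Z) = Z^t* *m Z.
    by rewrite mulmxA -(mulmxA (Z^t*)) Zu mulmx1.
  have herm : (Z^t* *m Z)^t* = Z^t* *m Z by rewrite adjmxM trmxCK.
  have GG : G *m G^t* = G.
    rewrite /G adjmxB herm trmx1 map_mx1 mulmxBl mul1mx mulmxBr mulmx1 proj.
    by rewrite subrr subr0.
  have -> : w x = 1 - G x x by rewrite /G 2![in RHS]mxE eqxx [in RHS]mxE opprB addrC subrK.
  rewrite lerBlDr lerDl -GG mxE; apply: sumr_ge0 => j _.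
  by rewrite !mxE mul_conjC_ge0.
have w_sum : \sum_x w x = k%:R.
  by rewrite -[LHS]/(\tr (Z^t* *m Z)) mxtrace_mulC Zu mxtrace1.
have -> : \sum_x (v 0 x)%:C * w x = (r *+ k)%:C + \sum_x (v 0 x - r)%:C * w x.
  rewrite -mulr_natr rmorphM rmorph_nat -w_sum mulr_sumr -big_split /=.
  by apply: eq_bigr => x _; rewrite -mulrDl -rmorphD addrC subrK.
rewrite rmorphD lerD2l rmorph_sum; apply: ler_sum => x _ /=.
apply: (@le_trans _ _ ((pos_part (v 0 x - r))%:C * w x)).
  by rewrite ler_wpM2r // lecR pos_part_ge.
by rewrite ler_piMr // ler0c pos_part_ge0.
Qed.
End Largest.

(** * Continuity and maximization over unitary matrices *)

From mathcomp Require Import boolp classical_sets topology normedtype derive.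
Import numFieldNormedType.Exports.
Local Open Scope classical_set_scope.

Section Continuity.
Variables (R : realType) (T : topologicalType).
Local Notation C := R[i].

(** Continuity through real and imaginary parts, which keeps to the topology of
    [R]. *)
Definition ccontinuous (f : T -> C) :=
  continuous (fun x => complex.Re (f x)) /\ continuous (fun x => complex.Im (f x)).

Definition mxcontinuous m n (F : T -> 'M[C]_(m, n)) :=
  forall i j, ccontinuous (fun x => F x i j).

Lemma ccontinuous_cst c : ccontinuous (fun=> c).
Proof. by split=> x; exact: cst_continuous. Qed.

Lemma eq_ccontinuous f g : f =1 g -> ccontinuous f -> ccontinuous g.
Proof. by move=> /funext ->. Qed.

Lemma ccontinuousD f g :
  ccontinuous f -> ccontinuous g -> ccontinuous (fun x => f x + g x).
Proof.
have ReD (y z : C) : complex.Re (y + z) = complex.Re y + complex.Re z.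
  by case: y z => [? ?] [? ?].
have ImD (y z : C) : complex.Im (y + z) = complex.Im y + complex.Im z.
  by case: y z => [? ?] [? ?].
move=> [fr fi] [gr gi]; split=> x.
  under eq_fun do rewrite ReD.
  by apply: cvgD; [exact: fr|exact: gr].
under eq_fun do rewrite ImD.
by apply: cvgD; [exact: fi|exact: gi].
Qed.

Lemma ccontinuousM f g :
  ccontinuous f -> ccontinuous g -> ccontinuous (fun x => f x * g x).
Proof.
have ReM (y z : C) : complex.Re (y * z) =
    complex.Re y * complex.Re z - complex.Im y * complex.Im z.
  by case: y z => [? ?] [? ?].
have ImM (y z : C) : complex.Im (y * z) =
    complex.Re y * complex.Im z + complex.Im y * complex.Re z.
  by case: y z => [? ?] [? ?].
move=> [fr fi] [gr gi]; split=> x.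
  under eq_fun do rewrite ReM.
  by apply: cvgB; apply: cvgM; [exact: fr|exact: gr|exact: fi|exact: gi].
under eq_fun do rewrite ImM.
by apply: cvgD; apply: cvgM; [exact: fr|exact: gi|exact: fi|exact: gr].
Qed.

Lemma ccontinuous_conj f : ccontinuous f -> ccontinuous (fun x => Num.conj (f x)).
Proof.
move=> [fr fi]; split=> x.
  rewrite (_ : (fun _ => _) = (fun y => complex.Re (f y))); first exact: fr.
  by apply/funext => y; case: (f y).
rewrite (_ : (fun _ => _) = (fun y => - complex.Im (f y))).
  by apply: cvgN; exact: fi.
by apply/funext => y; case: (f y).
Qed.

Lemma ccontinuous_sum (I : Type) (r : seq I) (P : pred I) (F : I -> T -> C) :
  (forall i, ccontinuous (F i)) -> ccontinuous (fun x => \sum_(i <- r | P i) F i x).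
Proof.
move=> cF; elim: r => [|i r IHr].
  by apply: eq_ccontinuous (ccontinuous_cst 0) => x; rewrite big_nil.
case Pi : (P i); last by apply: eq_ccontinuous IHr => x; rewrite big_cons Pi.
by apply: eq_ccontinuous (ccontinuousD (cF i) IHr) => x; rewrite big_cons Pi.
Qed.

Lemma ccontinuous_prod (I : Type) (r : seq I) (P : pred I) (F : I -> T -> C) :
  (forall i, ccontinuous (F i)) -> ccontinuous (fun x => \prod_(i <- r | P i) F i x).
Proof.
move=> cF; elim: r => [|i r IHr].
  by apply: eq_ccontinuous (ccontinuous_cst 1) => x; rewrite big_nil.
case Pi : (P i); last by apply: eq_ccontinuous IHr => x; rewrite big_cons Pi.
by apply: eq_ccontinuous (ccontinuousM (cF i) IHr) => x; rewrite big_cons Pi.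
Qed.

Lemma mxcontinuous_cst m n (M : 'M[C]_(m, n)) : mxcontinuous (fun=> M).
Proof. by move=> i j; exact: ccontinuous_cst. Qed.

Lemma mxcontinuousD m n (F G : T -> 'M[C]_(m, n)) :
  mxcontinuous F -> mxcontinuous G -> mxcontinuous (fun x => F x + G x).
Proof.
move=> cF cG i j.
by apply: eq_ccontinuous (ccontinuousD (cF i j) (cG i j)) => x; rewrite mxE.
Qed.

Lemma mxcontinuousM m n p (F : T -> 'M[C]_(m, n)) (G : T -> 'M[C]_(n, p)) :
  mxcontinuous F -> mxcontinuous G -> mxcontinuous (fun x => F x *m G x).
Proof.
move=> cF cG i j; apply: (@eq_ccontinuous (fun x => \sum_l F x i l * G x l j)).
  by move=> x; rewrite mxE.
by apply: ccontinuous_sum => l; exact: ccontinuousM.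
Qed.

Lemma mxcontinuous_adj m n (F : T -> 'M[C]_(m, n)) :
  mxcontinuous F -> mxcontinuous (fun x => (F x)^t*).
Proof.
move=> cF i j.
by apply: eq_ccontinuous (ccontinuous_conj (cF j i)) => x; rewrite !mxE.
Qed.

Lemma mxcontinuous_tensor n (d : 'I_n -> nat)
    (F : T -> forall i : 'I_n, 'M[C]_(d i)) :
  (forall i, mxcontinuous (fun x => F x i)) -> mxcontinuous (fun x => tensor_mx (F x)).
Proof.
move=> cF a b; apply: eq_ccontinuous (ccontinuous_prod _ _ _) => [x|].
  by rewrite mxE.
by move=> i; exact: cF.
Qed.

Lemma ccontinuous_mxtrace n (F : T -> 'M[C]_n) :
  mxcontinuous F -> ccontinuous (fun x => \tr (F x)).
Proof. by move=> cF; apply: ccontinuous_sum => i; exact: cF. Qed.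

Lemma closed_ccontinuous_ge f (c : R) : ccontinuous f -> closed [set x | c%:C <= f x].
Proof.
move=> [fr fi].
rewrite (_ : mkset _ = [set x | c <= complex.Re (f x)] `&` [set x | complex.Im (f x) = 0]).
  apply: closedI.
    exact: ((continuous_closedP _).1 fr _ (@closed_ge _ c)).
  exact: ((continuous_closedP _).1 fi _ (@closed_eq _ 0)).
apply/seteqP; split => x /=; rewrite lecE /=.
  by move=> /andP[/eqP -> ->].
by move=> [-> ->]; rewrite eqxx.
Qed.

Lemma closed_mxcontinuous_eq m n (F : T -> 'M[C]_(m, n)) M :
  mxcontinuous F -> closed [set x | F x = M].
Proof.
move=> cF.
rewrite (_ : mkset _ = \bigcap_(p in [set: 'I_m * 'I_n])
  ([set x | complex.Re (F x p.1 p.2) = complex.Re (M p.1 p.2)] `&`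
   [set x | complex.Im (F x p.1 p.2) = complex.Im (M p.1 p.2)])).
  apply: closed_bigI => p _; have [fr fi] := cF p.1 p.2; apply: closedI.
    exact: ((continuous_closedP _).1 fr _ (@closed_eq _ _)).
  exact: ((continuous_closedP _).1 fi _ (@closed_eq _ _)).
apply/seteqP; split => x /=; first by move=> FM p _ /=; rewrite FM.
move=> FM; apply/matrixP => i j; have /= [] := FM (i, j) Logic.I.
by case: (F x i j) (M i j) => [? ?] [? ?] /= -> ->.
Qed.
End Continuity.

Section Argmax.
Variables (R : realType) (S : finType) (p q : S -> nat).
Local Notation C := R[i].
Local Notation mxfamily := (forall s : S, 'M[C]_(p s, q s)).

(** Continuity without a topology on families of matrices: composition with any
    continuously parametrized family is continuous. *)
Definition family_continuous (f : mxfamily -> C) :=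
  forall (T : topologicalType) (F : T -> mxfamily),
  (forall s, mxcontinuous (fun x => F x s)) -> ccontinuous (fun x => f (F x)).

Lemma unitary_entry_bound m n (U : 'M[C]_(m, n)) i j : U \is unitarymx ->
  -1 <= complex.Re (U i j) <= 1 /\ -1 <= complex.Im (U i j) <= 1.
Proof.
move=> /unitarymxP/matrixP/(_ i i); rewrite !mxE eqxx => Ui.
have : `|U i j| ^+ 2 <= 1.
  rewrite -[leRHS]/(true%:R) -Ui (bigD1 j) //= !mxE normCK lerDl sumr_ge0 // => l _.
  by rewrite !mxE mul_conjC_ge0.
rewrite -add_Re2_Im2 -[1]/(1%:C) lecR => le1.
have sqr_le1 (x : R) : x ^+ 2 <= 1 -> -1 <= x <= 1.
  by rewrite -real_normK ?num_real // expr_le1 // ler_norml.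
by split; apply: sqr_le1; apply: le_trans le1; rewrite ?lerDl ?lerDr sqr_ge0.
Qed.

(** The real and imaginary parts of the entries of unitary matrices lie in
    [-1, 1], so the constraint set is a closed subset of a cube, and Tychonoff's
    theorem applies. *)
Lemma unitary_family_argmax (f g : mxfamily -> C) (c : R) :
  family_continuous f -> family_continuous g ->
  (exists2 U : mxfamily, forall s, U s \is unitarymx & c%:C <= f U) ->
  exists U : mxfamily, [/\ forall s, U s \is unitarymx, c%:C <= f U &
    forall V : mxfamily, (forall s, V s \is unitarymx) -> c%:C <= f V ->
      complex.Re (g V) <= complex.Re (g U)].
Proof.
move=> cf cg [U0 U0u fU0].
pose J : eqType := ({s : S & ('I_(p s) * 'I_(q s))%type} * bool)%type.
pose T := prod_topology (fun _ : J => R).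
pose slot (s : S) (a : 'I_(p s)) (b : 'I_(q s)) (o : bool) : J :=
  (existT (fun s => 'I_(p s) * 'I_(q s))%type s (a, b), o).
pose decode (x : T) : mxfamily := fun s =>
  \matrix_(a, b) (x (slot _ a b false) +i* x (slot _ a b true)).
pose encode (U : mxfamily) : T := fun j =>
  let z := U (tag j.1) (tagged j.1).1 (tagged j.1).2 in
  if j.2 then complex.Im z else complex.Re z.
have encodeK U : decode (encode U) = U.
  apply: functional_extensionality_dep => s; apply/matrixP => a b; rewrite mxE.
  by rewrite /encode /=; case: (U s a b).
have cdecode s : mxcontinuous (fun x => decode x s).
  move=> a b; apply: (@eq_ccontinuous _ _
    (fun x : T => x (slot _ a b false) +i* x (slot _ a b true))).
    by move=> x; rewrite mxE.
  by split; exact: (@proj_continuous J (fun=> R)).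
pose E := [set x : T | (forall s, decode x s *m (decode x s)^t* = 1%:M) /\
  c%:C <= f (decode x)].
have encodeE U : (forall s, U s \is unitarymx) -> c%:C <= f U -> E (encode U).
  by move=> Uu fU; rewrite /E /= encodeK; split => // s; exact/unitarymxP.
have compactE : compact E.
  apply: (@subclosed_compact _ _ [set x : T | forall j, `[-1, 1]%classic (x j)]).
  - rewrite (_ : E =
      (\bigcap_(s in [set: S]) [set x : T | decode x s *m (decode x s)^t* = 1%:M])
      `&` [set x : T | c%:C <= f (decode x)]).
      apply: closedI; last by apply: closed_ccontinuous_ge; exact: cf.
      apply: closed_bigI => s _; apply: closed_mxcontinuous_eq.
      by apply: mxcontinuousM => //; exact: mxcontinuous_adj.
    by apply/seteqP; split => x /= [xu xf]; split => // s; [move=> _|]; exact: xu.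
  - apply: (@tychonoff J (fun=> R) (fun=> `[-1, 1]%classic)) => _.
    exact: segment_compact.
  - move=> x [xu _] [[s [a b]] o] /=; rewrite in_itv /=.
    have [] := unitary_entry_bound a b (introT unitarymxP (xu s)).
    by rewrite mxE; case: o.
have [] := @compact_EVT_max T R (fun x => complex.Re (g (decode x))) E.
- by exists (encode U0); exact: encodeE.
- by [].
- by apply: continuous_subspaceT; exact: (cg _ decode cdecode).1.
move=> x /set_mem[xu xf] xmax; exists (decode x); split; [move=> s|exact: xf|move=> V Vu fV].
  exact/unitarymxP.
by rewrite -[V]encodeK; apply: xmax; apply: mem_set; exact: encodeE.
Qed.
End Argmax.

(** * Reduction to commuting factors *)

Section Main.
Variable R : realType.
Local Notation C := R[i].

Lemma tensor_trace_sum_le_swap n (d : 'I_n -> nat) k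
    (X Y : forall i : 'I_n, 'M[C]_(d i)) (Q : 'M[C]_(k, #|tindex d|)) :
  (forall i, Y i *m (X i)^t* \is hermsymmx) -> Q \is unitarymx ->
  exists2 Q' : 'M[C]_(k, #|tindex d|), Q' \is unitarymx &
    \tr (Q *m (tensor_mx (fun i => (X i)^t* *m X i) +
               tensor_mx (fun i => (Y i)^t* *m Y i)) *m Q^t*) <=
    \tr (Q' *m (tensor_mx (fun i => X i *m (X i)^t*) +
                tensor_mx (fun i => Y i *m (Y i)^t*)) *m Q'^t*).
Proof.
move=> hYX Qu; have := @trace_sum_le_swap _ k _ (tensor_mx X) (tensor_mx Y) Q.
rewrite !tensor_mx_adj !tensor_mxM; apply => //; exact: tensor_mx_herm.
Qed.

Definition csqrt d (v : 'rV[R]_d) : 'M[C]_d := cdiag (map_mx Num.sqrt v).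

Lemma csqrt_herm d (v : 'rV[R]_d) : csqrt v \is hermsymmx.
Proof. exact: cdiag_herm. Qed.

Lemma csqrtM d (v : 'rV[R]_d) : (forall j, 0 <= v 0 j) ->
  csqrt v *m csqrt v = cdiag v.
Proof.
move=> v_ge0; rewrite mulmx_diag; congr diag_mx; apply/rowP => j.
by rewrite !mxE -rmorphM -expr2 sqr_sqrtr.
Qed.

Lemma complex_le_antiRe (x y : C) : x <= y -> complex.Re y <= complex.Re x -> x = y.
Proof.
case: x y => [xr xi] [yr yi]; rewrite lecE /= => /andP[/eqP -> le1] le2.
by congr (_ +i* _); apply/le_anti; rewrite le1.
Qed.

Section Orbit.
Variables (n : nat) (d : 'I_n -> nat) (a b : forall i : 'I_n, 'rV[R]_(d i)).
Hypothesis a_ge0 : forall (i : 'I_n) (j : 'I_(d i)), 0 <= a i 0 j.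
Hypothesis b_ge0 : forall (i : 'I_n) (j : 'I_(d i)), 0 <= b i 0 j.
Variable k : nat.
Local Notation N := #|tindex d|.

Definition rotate (U : forall i : 'I_n, 'M[C]_(d i)) (i : 'I_n) : 'M[C]_(d i) :=
  U i *m cdiag (b i) *m (U i)^t*.

Definition compression (U : forall i : 'I_n, 'M[C]_(d i)) (Q : 'M[C]_(k, N)) : C :=
  \tr (Q *m (tensor_mx (fun i => cdiag (a i)) + tensor_mx (rotate U)) *m Q^t*).

Definition alignment (U : forall i : 'I_n, 'M[C]_(d i)) : C :=
  \sum_i \tr (cdiag (a i) *m rotate U i).

(** One swap at all sites.  The new pair of product operators has the diagonal
    matrices [cdiag (a i)] as first factors, so only the unitary matrices [W i]
    of the second factors have to be recorded. *)
Lemma compression_step (P P' : forall i : 'I_n, 'M[C]_(d i)) (Q : 'M[C]_(k, N)) :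
  (forall i, P i \is unitarymx) -> (forall i, P' i \is unitarymx) ->
  Q \is unitarymx ->
  exists (W : forall i : 'I_n, 'M[C]_(d i)) (Q' : 'M[C]_(k, N)),
  [/\ forall i, W i \is unitarymx,
      forall i, W i *m (csqrt (b i) *m P' i *m ((P i)^t* *m csqrt (a i))) \is hermsymmx,
      Q' \is unitarymx &
    \tr (Q *m (tensor_mx (fun i => (P i)^t* *m cdiag (a i) *m P i) +
               tensor_mx (fun i => (P' i)^t* *m cdiag (b i) *m P' i)) *m Q^t*)
    <= compression W Q'].
Proof.
move=> Pu P'u Qu.
have /fin_all_exists2[W Wu hW] := fun i =>
  polar_hermitian (csqrt (b i) *m P' i *m ((P i)^t* *m csqrt (a i))).
pose X i := csqrt (a i) *m P i; pose Y i := W i *m (csqrt (b i) *m P' i).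
have aE i := csqrtM (a_ge0 (i := i)); have bE i := csqrtM (b_ge0 (i := i)).
have YYE i : (Y i)^t* *m Y i = (P' i)^t* *m cdiag (b i) *m P' i.
  exact: (adj_gram_unitary_sqrt _ (Wu i) (csqrt_herm _) (bE i)).
have YYE' i : Y i *m (Y i)^t* = rotate W i.
  exact: (gram_unitary_sqrt _ (csqrt_herm _) (bE i) (P'u i)).
have XXE i : (X i)^t* *m X i = (P i)^t* *m cdiag (a i) *m P i.
  exact: (adj_gram_sqrt _ (csqrt_herm _) (aE i)).
have XXE' i : X i *m (X i)^t* = cdiag (a i).
  exact: (gram_sqrt (csqrt_herm _) (aE i) (Pu i)).
have [|Q' Q'u] := @tensor_trace_sum_le_swap n d k X Y Q _ Qu.
  by move=> i; rewrite (adjmxM (csqrt (a i))) (hermsymP _ (csqrt_herm _)) -mulmxA.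
rewrite (eq_tensor_mx XXE) (eq_tensor_mx YYE) (eq_tensor_mx XXE') (eq_tensor_mx YYE').
move=> le; exists W, Q'; split; [exact: Wu|exact: hW|exact: Q'u|exact: le].
Qed.

(* A configuration as a single family of matrices: [Some i] indexes the unitary
   matrix of site [i], and [None] the orthonormal rows of [Q]. *)
Let rows (s : option 'I_n) : nat := if s is Some i then d i else k.
Let cols (s : option 'I_n) : nat := if s is Some i then d i else N.
Let family := forall s : option 'I_n, 'M[C]_(rows s, cols s).
Let join (U : forall i : 'I_n, 'M[C]_(d i)) (Q : 'M[C]_(k, N)) : family :=
  fun s => match s return 'M[C]_(rows s, cols s) with
           | Some i => U i | None => Q end.

Lemma compression_continuous :
  family_continuous (fun U : family => compression (fun i => U (Some i)) (U None)).
Proof.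
move=> T F cF; apply: ccontinuous_mxtrace; apply: mxcontinuousM.
  apply: mxcontinuousM; first exact: (cF None).
  apply: mxcontinuousD; first exact: mxcontinuous_cst.
  apply: mxcontinuous_tensor => i; apply: mxcontinuousM.
    apply: mxcontinuousM; [exact: (cF (Some i))|exact: mxcontinuous_cst].
  by apply: mxcontinuous_adj; exact: (cF (Some i)).
by apply: mxcontinuous_adj; exact: (cF None).
Qed.

Lemma alignment_continuous :
  family_continuous (fun U : family => alignment (fun i => U (Some i))).
Proof.
move=> T F cF; apply: ccontinuous_sum => i; apply: ccontinuous_mxtrace.
apply: mxcontinuousM; first exact: mxcontinuous_cst.
apply: mxcontinuousM; last by apply: mxcontinuous_adj; exact: (cF (Some i)).
apply: mxcontinuousM; [exact: (cF (Some i))|exact: mxcontinuous_cst].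
Qed.

(** Maximize the alignment among the configurations whose compression is at least
    [c].  A swap stays within this set and does not decrease any summand of the
    alignment, so at a maximum every summand is preserved, and equality at site
    [i] means commutation at site [i]. *)
Lemma exists_commuting_compression (U0 : forall i : 'I_n, 'M[C]_(d i))
    (Q0 : 'M[C]_(k, N)) (c : R) :
  (forall i, U0 i \is unitarymx) -> Q0 \is unitarymx -> c%:C <= compression U0 Q0 ->
  exists (U : forall i : 'I_n, 'M[C]_(d i)) (Q : 'M[C]_(k, N)),
  [/\ forall i, U i \is unitarymx, Q \is unitarymx, c%:C <= compression U Q &
    forall i, cdiag (a i) *m rotate U i = rotate U i *m cdiag (a i)].
Proof.
move=> U0u Q0u cU0.
have joinu U Q : (forall i, U i \is unitarymx) -> Q \is unitarymx ->
    forall s, join U Q s \is unitarymx.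
  by move=> Uu Qu [i|]; [exact: Uu|exact: Qu].
have [|F [Fu cF Fmax]] :=
  unitary_family_argmax (c := c) compression_continuous alignment_continuous.
  by exists (join U0 Q0); [exact: joinu|exact: cU0].
pose U i : 'M[C]_(d i) := F (Some i); pose Q : 'M[C]_(k, N) := F None.
have Uu i : U i \is unitarymx by exact: (Fu (Some i)).
have Qu : Q \is unitarymx by exact: (Fu None).
exists U, Q; split; [exact: Uu|exact: Qu|exact: cF|].
have [|i||W [Q' [Wu hW Q'u le]]] := @compression_step (fun i => 1%:M) (fun i => (U i)^t*) Q.
- by move=> i; apply/unitarymxP; rewrite mul1mx trmx1 map_mx1.
- by rewrite trmxC_unitary; exact: Uu.
- exact: Qu.
have {le} cW : c%:C <= compression W Q'.
  move: le; rewrite (eq_tensor_mx (B := fun i => cdiag (a i))); last first.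
    by move=> i; rewrite trmx1 map_mx1 mul1mx mulmx1.
  rewrite [X in _ + X](eq_tensor_mx (B := rotate U)); last by move=> i; rewrite trmxCK.
  exact: (le_trans cF).
have hX i := csqrt_herm (a i).
pose Y i := W i *m (csqrt (b i) *m (U i)^t*).
have hYX i : Y i *m csqrt (a i) \is hermsymmx.
  by have := hW i; rewrite trmx1 map_mx1 mul1mx /Y !mulmxA.
have YY i : Y i *m (Y i)^t* = rotate W i.
  apply: (gram_unitary_sqrt _ (csqrt_herm _) (csqrtM (b_ge0 (i := i)))).
  by rewrite trmxC_unitary; exact: Uu.
have Y'Y i : (Y i)^t* *m Y i = rotate U i.
  rewrite /rotate -{1}[U i]trmxCK.
  exact: (adj_gram_unitary_sqrt _ (Wu i) (csqrt_herm _) (csqrtM (b_ge0 (i := i)))).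
(* At site [i] the swap exchanges [Y^H Y] and [Y Y^H] while fixing
   [cdiag (a i)]. *)
have le i : \tr (cdiag (a i) *m rotate U i) <= \tr (cdiag (a i) *m rotate W i).
  rewrite -(csqrtM (a_ge0 (i := i))) -YY -Y'Y; exact: trace_swap_le.
have eq i : \tr (cdiag (a i) *m rotate W i) = \tr (cdiag (a i) *m rotate U i).
  have leA : alignment U <= alignment W by apply: ler_sum => j _; exact: le.
  have leRe : complex.Re (alignment W) <= complex.Re (alignment U).
    exact: (Fmax (join W Q') (joinu _ _ Wu Q'u) cW).
  have /eqP := complex_le_antiRe leA leRe; rewrite eq_sym -subr_eq0.
  rewrite -sumrB psumr_eq0 => [|j _]; last by rewrite subr_ge0.
  by move=> /allP/(_ i (mem_index_enum i)); rewrite subr_eq0 => /eqP.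
move=> i; rewrite -(csqrtM (a_ge0 (i := i))) -Y'Y.
apply: (trace_swap_eq_comm (hX i) (hYX i)).
rewrite (csqrtM (a_ge0 (i := i))) YY Y'Y; exact: eq.
Qed.
End Orbit.
End Main.

(** * The commuting case and the theorem *)

Section Final.
Variable R : realType.
Local Notation C := R[i].

Lemma tensor_mx_cdiag n (d : 'I_n -> nat) (v : forall i : 'I_n, 'rV[R]_(d i)) :
  tensor_mx (fun i => cdiag (v i)) = cdiag (tensor_rv v).
Proof.
rewrite tensor_mx_diag; congr diag_mx; apply/rowP => x; rewrite !mxE rmorph_prod.
by apply: eq_bigr => i _; rewrite mxE.
Qed.

Lemma tensor_mx_unitary_conj n (d : 'I_n -> nat) (P : forall i : 'I_n, 'M[C]_(d i))
    (v : forall i : 'I_n, 'rV[R]_(d i)) :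
  tensor_mx (fun i => (P i)^t* *m cdiag (v i) *m P i) =
  (tensor_mx P)^t* *m cdiag (tensor_rv v) *m tensor_mx P.
Proof. by rewrite tensor_mx_adj -tensor_mx_cdiag !tensor_mxM. Qed.

(** Diagonalizing each commuting pair gives a product basis in which the entries
    of the sum are a coordinatewise rearrangement of those of
    [tensor_rv a + tensor_rv b]. *)
Lemma commuting_compression_le n (d : 'I_n -> nat) (a b : forall i : 'I_n, 'rV[R]_(d i))
    k (U : forall i : 'I_n, 'M[C]_(d i)) (Q : 'M[C]_(k, #|tindex d|)) r :
  (forall (i : 'I_n) (j : 'I_(d i)), 0 <= a i 0 j) ->
  (forall (i : 'I_n) (j : 'I_(d i)), 0 <= b i 0 j) ->
  (forall (i : 'I_n) (j l : 'I_(d i)), (j <= l)%N -> a i 0 l <= a i 0 j) ->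
  (forall (i : 'I_n) (j l : 'I_(d i)), (j <= l)%N -> b i 0 l <= b i 0 j) ->
  (forall i, U i \is unitarymx) -> Q \is unitarymx ->
  (forall i, cdiag (a i) *m rotate b U i = rotate b U i *m cdiag (a i)) ->
  compression a b U Q <=
  (r *+ k + \sum_x pos_part ((tensor_rv a + tensor_rv b) 0 x - r))%:C.
Proof.
move=> a_ge0 b_ge0 a_mono b_mono Uu Qu comm.
have diag i : exists P (s t : 'S_(d i)), [/\ P \is unitarymx,
    cdiag (a i) = P^t* *m cdiag (\row_j a i 0 (s j)) *m P &
    rotate b U i = P^t* *m cdiag (\row_j b i 0 (t j)) *m P].
  have := @comm_hermitian_diag R (d i) (a i) (b i) 1%:M ((U i)^t*).
  rewrite trmx1 map_mx1 mul1mx mulmx1 trmxCK trmxC_unitary; apply.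
  - by apply/unitarymxP; rewrite mul1mx trmx1 map_mx1.
  - exact: Uu.
  - exact: comm.
have {diag} /fin_all_exists[P /fin_all_exists[s /fin_all_exists[t diag]]] := diag.
have Pu : tensor_mx P \is unitarymx by apply: tensor_mx_unitary => i; case: (diag i).
rewrite /compression (eq_tensor_mx (A := fun i => cdiag (a i))
  (B := fun i => (P i)^t* *m cdiag (\row_j a i 0 (s i j)) *m P i)); last first.
  by move=> i; case: (diag i).
rewrite (eq_tensor_mx (A := rotate b U)
  (B := fun i => (P i)^t* *m cdiag (\row_j b i 0 (t i j)) *m P i)); last first.
  by move=> i; case: (diag i).
rewrite (tensor_mx_unitary_conj P (fun i => \row_j a i 0 (s i j))).
rewrite (tensor_mx_unitary_conj P (fun i => \row_j b i 0 (t i j))) -mulmxDl -mulmxDr.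
set va := tensor_rv _; set vb := tensor_rv _.
have -> : cdiag va + cdiag vb = cdiag (va + vb).
  by rewrite /cdiag map_mxD linearD.
apply: le_trans (trace_compression_le _ r Qu Pu) _; rewrite lecR lerD2l.
have sumE (v w : 'rV[R]_#|tindex d|) (F : tindex d -> R) :
    (forall x, (v + w) 0 x = F (enum_val x)) ->
    \sum_x pos_part ((v + w) 0 x - r) = \sum_(x : tindex d) pos_part (F x - r).
  by move=> vF; rewrite sum_enum_tindex; apply: eq_bigr => x _; rewrite vF.
rewrite (sumE va vb (fun x => \prod_i a i 0 (s i (x i)) + \prod_i b i 0 (t i (x i)))); last first.
  by move=> x; rewrite !mxE; congr (_ + _); apply: eq_bigr => i _; rewrite mxE.
rewrite (sumE (tensor_rv a) (tensor_rv b)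
  (fun x => \prod_i a i 0 (x i) + \prod_i b i 0 (x i))); last first.
  by move=> x; rewrite !mxE.
have := @total_excess_le_sorted R n d (fun i j => a i 0 j) (fun i j => b i 0 j) r s t
  a_ge0 b_ge0 a_mono b_mono.
rewrite /total_excess => /le_trans; apply; rewrite le_eqVlt; apply/orP; left; apply/eqP.
apply: eq_bigr => x _; congr (pos_part (_ + _ - _));
by apply: eq_bigr => i _; rewrite perm1.
Qed.

Lemma sum_lambda_mxtrace d (A : 'M[C]_d) : A \is hermsymmx ->
  (\sum_i lambda A 0 i)%:C = \tr A.
Proof.
move=> hA; have [P Pu {2}->] := hermitian_diag_lambda hA.
rewrite mxtrace_mulC mulmxA (unitarymxP Pu) mul1mx mxtrace_diag rmorph_sum /=.
by apply: eq_bigr => i _; rewrite [RHS]mxE.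
Qed.

Lemma prod_sum_lambda_mxtrace n (d : 'I_n -> nat) (A : forall i : 'I_n, 'M[C]_(d i)) :
  (forall i, A i \is hermsymmx) ->
  (\prod_i \sum_j lambda (A i) 0 j)%:C = \tr (tensor_mx A).
Proof.
move=> hA; rewrite mxtrace_tensor rmorph_prod.
by apply: eq_bigr => i _; exact: sum_lambda_mxtrace.
Qed.

Lemma sum_tensor_rvD n (d : 'I_n -> nat) (a b : forall i : 'I_n, 'rV[R]_(d i)) :
  \sum_x (tensor_rv a + tensor_rv b) 0 x =
  \prod_i \sum_j a i 0 j + \prod_i \sum_j b i 0 j.
Proof.
rewrite !(prodr_sum_dffun (R := R)) !(sum_enum_tindex (R := R)) -big_split /=.
by apply: eq_bigr => x _; rewrite !mxE.
Qed.
End Final.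

Theorem theorem1p1 (R : realType) (n : nat) (d : 'I_n -> nat)
    (A B : forall i : 'I_n, 'M[R[i]]_(d i)) :
  (0 < n)%N ->
  (forall i : 'I_n, (0 < d i)%N) ->
  (forall i : 'I_n, psdmx (A i)) ->
  (forall i : 'I_n, psdmx (B i)) ->
  majorized
    (lambda (tensor_mx A + tensor_mx B))
    (tensor_rv (fun i : 'I_n => lambda (A i)) +
     tensor_rv (fun i : 'I_n => lambda (B i))).
Proof.
move=> _ _ psdA psdB.
have hA i : A i \is hermsymmx by case: (psdA i).
have hB i : B i \is hermsymmx by case: (psdB i).
have hM : tensor_mx A + tensor_mx B \is hermsymmx.
  apply/hermsymP; rewrite adjmxD.
  by congr (_ + _); apply/hermsymP/tensor_mx_herm.
split=> [k /andP[k_gt0 kN]|]; last first.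
  apply: complexI; rewrite (sum_lambda_mxtrace hM) mxtraceD.
  rewrite -(prod_sum_lambda_mxtrace hA) -(prod_sum_lambda_mxtrace hB) sum_tensor_rvD.
  exact: rmorphD.
have [Q0 Q0u Q0E] := sum_largest_attained hM (ltnW kN).
have a_ge0 (i : 'I_n) (j : 'I_(d i)) : 0 <= lambda (A i) 0 j by exact: psdmx_lambda_ge0.
have b_ge0 (i : 'I_n) (j : 'I_(d i)) : 0 <= lambda (B i) 0 j by exact: psdmx_lambda_ge0.
have /fin_all_exists2[P Pu AP] := fun i => hermitian_diag_lambda (hA i).
have /fin_all_exists2[P' P'u BP'] := fun i => hermitian_diag_lambda (hB i).
have [W [Q [Wu _ Qu]]] := compression_step a_ge0 b_ge0 Pu P'u Q0u.
rewrite -(eq_tensor_mx AP) -(eq_tensor_mx BP') Q0E => le0.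
have [U [Q' [Uu Q'u le1 comm]]] := exists_commuting_compression a_ge0 b_ge0 Wu Qu le0.
set h := tensor_rv _ + tensor_rv _.
have [|r ->] := @sum_largest_threshold R _ h k; first by rewrite k_gt0 ltnW.
rewrite -lecR; apply: le_trans le1 _.
apply: commuting_compression_le a_ge0 b_ge0 _ _ Uu Q'u comm => i j l;
exact: lambda_nonincreasing.
Qed.
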